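(* Let $E$ be a pseudo effect algebra with (RDP), and let $F$ be a face of the state space $\mathcal S(E)$. Assume that $V(F)$ is $\vee$-closed. Then $\mathcal S(E)$ is the direct convex sum of $F$ and its complementary face $F'$. In addition, every measure $m$ on $E$ can be uniquely decomposed as a sum $m=m_1+m_2$ of two measures such that $m_1\in V(F)$ and $m_2\in V(F')$.
   Context: A pseudo effect algebra is a partial algebra $(E;+,0,1)$ with a partial binary operation $+$ and constants $0,1$ such that for all $a,b,c\in E$: (i) $a+b$ and $(a+b)+c$ exist iff $b+c$ and $a+(b+c)$ exist, and then $(a+b)+c=a+(b+c)$; (ii) there is exactly one $d$ and exactly one $e$ in $E$ with $a+d=e+a=1$; (iii) if $a+b$ exists, there are $d,e\in E$ with $a+b=d+a=b+e$; (iv) if $1+a$ or $a+1$ exists, then $a=0$. The partial order on $E$ is $a\le b$ iff $a+c=b$ for some $c\in E$. $E$ has (RDP) if whenever $a_1+a_2=b_1+b_2$ (both sums defined), there are $d_1,d_2,d_3,d_4\in E$ with $d_1+d_2=a_1$, $d_3+d_4=a_2$, $d_1+d_3=b_1$, $d_2+d_4=b_2$. A signed measure is a map $m:E\to\mathbb R$ with $m(a+b)=m(a)+m(b)$ whenever $a+b$ is defined; a measure is a signed measure with $m(a)\ge 0$ for all $a$; a state is a measure with $s(1)=1$. $\mathcal M^+(E)$ and $\mathcal S(E)$ denote the sets of measures and of states; $\mathcal J(E)$ is the set of Jordan signed measures, i.e. differences of two measures. Write $m_1\le^+m_2$ if $m_1(a)\le m_2(a)$ for all $a\in E$; when $E$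 has (RDP), $\mathcal J(E)$ ordered by $\le^+$ is a Dedekind complete Abelian $\ell$-group, and suprema and infima of measures are taken in it. A face of a convex set $K$ is a convex subset $F\subseteq K$ (possibly empty) such that $\lambda x_1+(1-\lambda)x_2\in F$ with $x_1,x_2\in K$, $\lambda\in(0,1)$ implies $x_1,x_2\in F$. The complementary face $F'$ of a face $F$ of $\mathcal S(E)$ is the union of all faces of $\mathcal S(E)$ disjoint from $F$ (it is a face, because $\mathcal S(E)$ is empty or a simplex). $K$ is the direct convex sum of convex subsets $K_1,K_2$ if $K$ is the convex hull of $K_1\cup K_2$ and every element of $K$ is uniquely a convex combination of elements $x_i\in K_i$: if $\alpha_1x_1+\alpha_2x_2=\beta_1y_1+\beta_2y_2$ are convex combinations with $x_i,y_i\in K_i$, then $\alpha_i=\beta_i$ for $i=1,2$, and $x_i=y_i$ for those $i$ with $\alpha_i>0$. A term with coefficient $0$ may be omitted (relevant if some $K_i$ is empty). For a face $F$ of $\mathcal S(E)$, $V(F):=\{\alpha s:\alpha\ge 0,\ s\in F\}$, with $V(\emptyset)=\{0\}$. $V(F)$ is $\vee$-closed if for every (nonempty) chain $\{m_i\}$ (with respect to $\le^+$) in $V(F)$ that is bounded above in $\mathcal M^+(E)$, $\bigvee_i m_i\in V(F)$. *)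

(* Defs.v *)
From HB Require Import structures.
From mathcomp Require Import all_boot all_order all_algebra.
From mathcomp Require Import boolp classical_sets functions reals convex.

Set Implicit Arguments.
Unset Strict Implicit.
Unset Printing Implicit Defensive.

Import Order.TTheory GRing.Theory Num.Theory.

Local Open Scope classical_set_scope.
Local Open Scope ring_scope.

(* The partial addition is option-valued: [padd a b = Some c] means that
   a + b is defined and equal to c.  Equality in [option E] in [paddA] says at
   once that both bracketings are defined together and then agree. *)
HB.mixin Record isPseudoEffectAlgebra (E : Type) := {
  padd : E -> E -> option E;
  pea0 : E;
  pea1 : E;
  paddA : forall a b c : E,
    obind (fun d => padd d c) (padd a b) = obind (padd a) (padd b c);
  padd_compl : forall a : E,
    (exists! d, padd a d = Some pea1) /\ (exists! e, padd e a = Some pea1);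
  padd_conj : forall a b c : E, padd a b = Some c ->
    exists d e, padd d a = Some c /\ padd b e = Some c;
  padd1_eq0 : forall a : E,
    padd pea1 a <> None \/ padd a pea1 <> None -> a = pea0
}.

#[short(type=peaType)]
HB.structure Definition PseudoEffectAlgebra := {E of isPseudoEffectAlgebra E}.

Definition RDP (E : peaType) : Prop :=
  forall a1 a2 b1 b2 c : E, padd a1 a2 = Some c -> padd b1 b2 = Some c ->
  exists d1 d2 d3 d4 : E,
    [/\ padd d1 d2 = Some a1, padd d3 d4 = Some a2,
        padd d1 d3 = Some b1 & padd d2 d4 = Some b2].

Section ConvexSets.
Variables (R : realType) (V : lmodType R).
Implicit Types (K F G : set V).

Definition convex_hull K : set V := smallest (@convex_set R V) K.

Definition is_face K F : Prop :=
  [/\ convex_set F, F `<=` K &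
      forall (x1 x2 : V) (l : R), K x1 -> K x2 -> 0 < l < 1 ->
        F (l *: x1 + (1 - l) *: x2) -> F x1 /\ F x2].

Definition complementary_face K F : set V :=
  \bigcup_(G in [set G | is_face K G /\ G `&` F = set0]) G.

(* [a1 *: x1 + a2 *: x2] is a convex combination with [x_i] in [K_i]; a term
   with coefficient 0 counts as omitted, so its [x_i] is unconstrained. *)
Definition convex_comb2 (K1 K2 : set V) (a1 : R) (x1 : V) (a2 : R) (x2 : V)
    : Prop :=
  [/\ 0 <= a1, 0 <= a2, a1 + a2 = 1, (0 < a1 -> K1 x1) & (0 < a2 -> K2 x2)].

Definition direct_convex_sum K (K1 K2 : set V) : Prop :=
  [/\ convex_set K1 /\ K1 `<=` K,
      convex_set K2 /\ K2 `<=` K,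
      K = convex_hull (K1 `|` K2),
      forall x, K x -> exists a1 x1 a2 x2,
        convex_comb2 K1 K2 a1 x1 a2 x2 /\ x = a1 *: x1 + a2 *: x2
    & forall a1 x1 a2 x2 b1 y1 b2 y2,
        convex_comb2 K1 K2 a1 x1 a2 x2 -> convex_comb2 K1 K2 b1 y1 b2 y2 ->
        a1 *: x1 + a2 *: x2 = b1 *: y1 + b2 *: y2 ->
        [/\ a1 = b1, a2 = b2, (0 < a1 -> x1 = y1) & (0 < a2 -> x2 = y2)]].

(* Adding 0 only matters for [F] empty, where V(F) = {0} by convention. *)
Definition face_cone F : set V :=
  [set m | m = 0 \/ exists (a : R) (s : V), [/\ 0 <= a, F s & m = a *: s]].

End ConvexSets.

(* Codomain [R^o]: the library's module structure on [E -> R^o] is pointwise,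
   and so is its order [<=%O] (lemma [lefP]). *)
Section Measures.
Variables (R : realType) (E : peaType).
Implicit Types (m : E -> R^o) (C V : set (E -> R^o)).

Definition signed_measure m : Prop :=
  forall a b c : E, padd a b = Some c -> m c = m a + m b.

Definition measures : set (E -> R^o) :=
  [set m | signed_measure m /\ forall a, 0 <= m a].

Definition states : set (E -> R^o) :=
  [set s | measures s /\ s pea1 = 1].

Definition jordan_measures : set (E -> R^o) :=
  [set m | exists m1 m2, [/\ measures m1, measures m2 & m = m1 - m2]].

Definition is_jordan_sup C m : Prop :=
  [/\ jordan_measures m, ubound C m &
      forall n, jordan_measures n -> ubound C n -> (m <= n)%O].

Definition vee_closed V : Prop :=
  forall C, C !=set0 -> C `<=` V -> total_on C <=%O ->
    (exists2 u, measures u & ubound C u) ->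
    forall m, is_jordan_sup C m -> V m.

End Measures.

Arguments measures R E : clear implicits.
Arguments states R E : clear implicits.
Arguments jordan_measures R E : clear implicits.

(* Main.v *)
(* V(F) is a cone that is hereditary among measures.  Since V(F) is
   vee-closed, Zorn's lemma gives, for a measure m, a maximal n in V(F) below m,
   and by maximality no nonzero element of V(F) lies below m - n.  The measures
   above no nonzero element of V(F) are exactly those of V(F'): the face
   generated by a state s consists of the states t with l t <= s for some l > 0.
   (RDP) makes infima of measures additive, hence measures have the Riesz
   decomposition property; this yields the convexity of F' and uniqueness. *)
Require Import Defs.
From mathcomp Require Import all_boot all_order all_algebra.
From mathcomp Require Import boolp classical_sets functions reals convex.
From mathcomp Require Import interval_inference ring lra.

Set Implicit Arguments.
Unset Strict Implicit.
Unset Printing Implicit Defensive.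

Import Order.TTheory GRing.Theory Num.Theory.

Local Open Scope classical_set_scope.
Local Open Scope ring_scope.

(** * Partial addition: reassociation and the neutral element *)

Section PseudoEffectAlgebra.
Variable E : peaType.
Implicit Types a b c d e : E.

Lemma padd_assocr a b c d e : padd a b = Some d -> padd d c = Some e ->
  exists2 f, padd b c = Some f & padd a f = Some e.
Proof.
move=> abd dce; have := paddA a b c; rewrite abd /= dce.
by case: (padd b c) => [f|] //= af; exists f.
Qed.

Lemma padd_assocl a b c d e : padd b c = Some d -> padd a d = Some e ->
  exists2 f, padd a b = Some f & padd f c = Some e.
Proof.
move=> bcd ade; have := paddA a b c; rewrite bcd /= ade.
by case: (padd a b) => [f|] //= fc; exists f.
Qed.

Lemma padd10 : padd (pea1 : E) pea0 = Some pea1.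
Proof.
have [[d [d1 _]] _] := padd_compl (pea1 : E).
by rewrite -[pea0](padd1_eq0 d) //; left; rewrite d1.
Qed.

Lemma padd01 : padd (pea0 : E) pea1 = Some pea1.
Proof.
have [_ [d [d1 _]]] := padd_compl (pea1 : E).
by rewrite -[pea0](padd1_eq0 d) //; right; rewrite d1.
Qed.

(** With [b + a = 1] also [b + (a + 0) = 1 + 0 = 1], and the right complement of [b] is unique. *)
Lemma paddx0 a : padd a pea0 = Some a.
Proof.
have [_ [b [b1 _]]] := padd_compl a.
have [f af bf] := padd_assocr b1 padd10.
have [[g [_ gu]] _] := padd_compl b.
by rewrite af -(gu _ bf) -(gu _ b1).
Qed.

Lemma padd0x a : padd pea0 a = Some a.
Proof.
have [[b [b1 _]] _] := padd_compl a.
have [f af bf] := padd_assocl b1 padd01.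
have [_ [g [_ gu]]] := padd_compl b.
by rewrite af -(gu _ bf) -(gu _ b1).
Qed.

End PseudoEffectAlgebra.

(** * Measures, their infima and Riesz decomposition *)

Section Measures.
Variables (R : realType) (E : peaType).
Implicit Types (m n k : E -> R^o) (r : R) (a b c : E).

Lemma signed_measure0 m : signed_measure m -> m pea0 = 0.
Proof. by move=> /(_ _ _ _ (paddx0 pea0)) m0; lra. Qed.

Lemma measures0 : measures R E 0.
Proof. by split=> [a b c _|a //]; rewrite addr0. Qed.

Lemma measuresD m n : measures R E m -> measures R E n -> measures R E (m + n).
Proof.
move=> [sm m0] [sn n0]; split=> [a b c abc|a]; last exact: addr_ge0.
by rewrite !fctE (sm _ _ _ abc) (sn _ _ _ abc) addrACA.
Qed.

Lemma measuresZ r m : 0 <= r -> measures R E m -> measures R E (r *: m).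
Proof.
move=> r0 [sm m0]; split=> [a b c abc|a]; last exact: mulr_ge0.
by rewrite !fctE (sm _ _ _ abc) scalerDr.
Qed.

Lemma measuresB m n : measures R E m -> measures R E n -> (m <= n)%O ->
  measures R E (n - m).
Proof.
move=> [sm _] [sn _] /lefP mn; split=> [a b c abc|a];
  last by rewrite !fctE subr_ge0.
by rewrite !fctE (sm _ _ _ abc) (sn _ _ _ abc) opprD addrACA.
Qed.

Lemma measures_le1 m a : measures R E m -> m a <= m pea1.
Proof.
move=> [sm m0]; have [[d [d1 _]] _] := padd_compl a.
by rewrite (sm _ _ _ d1) lerDl.
Qed.

Lemma measures_eq0 m : measures R E m -> m pea1 <= 0 -> m = 0.
Proof.
move=> mm m1; apply/funext => a; apply/le_anti/andP; split; last exact: mm.2.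
exact: le_trans (measures_le1 a mm) m1.
Qed.

Lemma normalized_state m : measures R E m -> 0 < m pea1 ->
  states R E ((m pea1)^-1 *: m).
Proof.
move=> mm m1; split; first by apply: measuresZ => //; rewrite invr_ge0 ltW.
by rewrite fctE /GRing.scale /= mulVf // gt_eqF.
Qed.

(** The Riesz-Kantorovich formula for the infimum of two measures. The set contains the value at
    [a = a + 0] and, for measures, is bounded below by 0, so [inf] is a genuine infimum. *)
Definition mmeet m n : E -> R^o := fun a =>
  inf [set r | exists b c, padd b c = Some a /\ r = m b + n c].

Lemma le_mmeet m n a r :
  (forall b c, padd b c = Some a -> r <= m b + n c) -> r <= mmeet m n a.
Proof.
move=> lem; apply: lb_le_inf => [|_ [b [c [bc ->]]]]; last exact: lem.
by exists (m a + n pea0), a, pea0; rewrite paddx0.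
Qed.

Lemma mmeet_le_padd m n a b c : measures R E m -> measures R E n ->
  padd b c = Some a -> mmeet m n a <= m b + n c.
Proof.
move=> [_ m0] [_ n0] bc; apply: ge_inf; last by exists b, c.
by exists 0 => _ [b' [c' [_ ->]]]; rewrite addr_ge0.
Qed.

Lemma mmeet_le_l m n : measures R E m -> measures R E n -> (mmeet m n <= m)%O.
Proof.
move=> mm mn; apply/lefP => a; have := mmeet_le_padd mm mn (paddx0 a).
by rewrite (signed_measure0 mn.1) addr0.
Qed.

Lemma mmeet_le_r m n : measures R E m -> measures R E n -> (mmeet m n <= n)%O.
Proof.
move=> mm mn; apply/lefP => a; have := mmeet_le_padd mm mn (padd0x a).
by rewrite (signed_measure0 mm.1) add0r.
Qed.

(** The lower bound [k] may take negative values: Riesz decomposition applies this to a difference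
    of measures. *)
Lemma mmeet_glb m n k : signed_measure k -> (k <= m)%O -> (k <= n)%O ->
  (k <= mmeet m n)%O.
Proof.
move=> sk /lefP km /lefP kn; apply/lefP => a; apply: le_mmeet => b c bc.
by rewrite (sk _ _ _ bc) lerD.
Qed.

(** Subadditivity joins decompositions of [x] and [y] into one of [z], after swapping the two middle
    summands. Superadditivity rests on (RDP), which refines a decomposition of [z] into
    decompositions of [x] and [y]. *)
Lemma mmeet_measure m n : RDP E -> measures R E m -> measures R E n ->
  measures R E (mmeet m n).
Proof.
move=> rdp mm mn; have [[sm m0] [sn n0]] := (mm, mn).
split=> [x y z xyz|a]; last first.
  by apply: le_mmeet => b c _; rewrite addr_ge0.
apply/le_anti/andP; split.
  rewrite -lerBlDr; apply: le_mmeet => b1 c1 x1.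
  rewrite lerBlDr -lerBlDl; apply: le_mmeet => b2 c2 y2.
  rewrite lerBlDl.
  have [u c1y b1u] := padd_assocr x1 xyz.
  have [v c1b2 vc2] := padd_assocl y2 c1y.
  (* [c1] moves past [b2] at the cost of a conjugate [d] with [m d = m b2]. *)
  have [d [_ [dc1 _]]] := padd_conj _ _ _ c1b2.
  have [w c1c2 dw] := padd_assocr dc1 vc2.
  have [p b1d pw] := padd_assocl dw b1u.
  apply: le_trans (mmeet_le_padd mm mn pw) _.
  rewrite (sm _ _ _ b1d) (sn _ _ _ c1c2).
  have := sm _ _ _ c1b2; rewrite (sm _ _ _ dc1) => e.
  by lra.
apply: le_mmeet => b c bc.
have [d1 [d2 [d3 [d4 [x12 y34 b13 c24]]]]] := rdp _ _ _ _ _ xyz bc.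
rewrite (sm _ _ _ b13) (sn _ _ _ c24) addrACA.
by apply: lerD; apply: mmeet_le_padd.
Qed.

(** The parts are [mmeet k m] and the rest. The rest is below [n] because [k - n] is a signed
    measure below both [k] and [m], hence below their infimum. *)
Lemma measures_riesz k m n : RDP E ->
  measures R E k -> measures R E m -> measures R E n -> (k <= m + n)%O ->
  exists k1 k2, [/\ measures R E k1, measures R E k2,
    (k1 <= m)%O, (k2 <= n)%O & k = k1 + k2].
Proof.
move=> rdp mk mm mn /lefP kmn; have mkm := mmeet_measure rdp mk mm.
exists (mmeet k m), (k - mmeet k m); split=> //; last by rewrite addrC subrK.
- exact: measuresB (mmeet_le_l mk mm).
- exact: mmeet_le_r.
have /lefP knk : (k - n <= mmeet k m)%O.
  apply: mmeet_glb.
  + move=> a b c abc; rewrite !fctE (mk.1 _ _ _ abc) (mn.1 _ _ _ abc).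
    by rewrite opprD addrACA.
  + by apply/lefP => a; rewrite !fctE gerBl; exact: mn.2.
  + by apply/lefP => a; rewrite !fctE lerBlDr; exact: kmn.
by apply/lefP => a; have := knk a; rewrite !fctE lerBlDr lerBlDl.
Qed.

Lemma measures_le_addr m n : measures R E n -> (m <= m + n)%O.
Proof. by move=> [_ n0]; apply/lefP => a; rewrite fctE lerDl. Qed.

End Measures.

(** * Suprema of bounded chains of measures *)

Section ChainSup.
Variables (R : realType) (E : peaType) (C : set (E -> R^o)) (u : E -> R^o).
Hypotheses (C0 : C !=set0) (Cm : C `<=` measures R E).
Hypotheses (Cchain : total_on C <=%O) (Cu : ubound C u).

Definition pointwise_sup : E -> R^o := fun a => sup [set n a | n in C].

Lemma le_pointwise_sup n a : C n -> n a <= pointwise_sup a.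
Proof.
move=> Cn; apply: ub_le_sup; last by exists n.
by exists (u a) => _ [k Ck <-]; exact/lefP/Cu.
Qed.

Lemma pointwise_sup_le a (r : R) : (forall n, C n -> n a <= r) ->
  pointwise_sup a <= r.
Proof.
move=> ler; apply: ge_sup => [|_ [n Cn <-]]; last exact: ler.
by have [n Cn] := C0; exists (n a), n.
Qed.

Lemma pointwise_sup_measure : measures R E pointwise_sup.
Proof.
split=> [a b c abc|a]; last first.
  by have [n Cn] := C0; exact: le_trans ((Cm Cn).2 a) (le_pointwise_sup a Cn).
apply/le_anti/andP; split.
  apply: pointwise_sup_le => n Cn; rewrite ((Cm Cn).1 _ _ _ abc).
  by apply: lerD; exact: le_pointwise_sup.
rewrite -lerBrDr; apply: pointwise_sup_le => n Cn.
rewrite lerBrDr -lerBrDl; apply: pointwise_sup_le => k Ck; rewrite lerBrDl.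
(* Here the chain condition enters: the larger of [n] and [k] serves at both [a] and [b], and it is
   additive. *)
have [/lefP nk|/lefP kn] := Cchain Cn Ck.
  apply: le_trans (le_pointwise_sup c Ck); rewrite ((Cm Ck).1 _ _ _ abc).
  by rewrite lerD2r; exact: nk.
apply: le_trans (le_pointwise_sup c Cn); rewrite ((Cm Cn).1 _ _ _ abc).
by rewrite lerD2l; exact: kn.
Qed.

Lemma pointwise_sup_jordan : is_jordan_sup C pointwise_sup.
Proof.
split=> [|n Cn|n _ Cn].
- by exists pointwise_sup, 0; rewrite subr0; split=> //;
    [exact: pointwise_sup_measure|exact: measures0].
- by apply/lefP => a; exact: le_pointwise_sup.
- by apply/lefP => a; apply: pointwise_sup_le => k Ck; exact/lefP/Cn.
Qed.

End ChainSup.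

(** * Convexity with real coefficients *)

Section Convexity.
Variables (R : realType) (V : lmodType R).
Implicit Types (A : set V) (x y : V) (l r : R).

(** Trades interval-typed coefficients for reals strictly between 0 and 1, as in the definition of
    faces; at the endpoints the combination is [x] or [y]. *)
Lemma convex_setE A : convex_set A <->
  forall x y l, A x -> A y -> 0 < l < 1 -> A (l *: x + (1 - l) *: y).
Proof.
split=> [cA x y l Ax Ay /andP[l0 l1]|cA].
  have := cA x y (Itv01 (ltW l0) (ltW l1)); rewrite !inE; exact.
apply/convex_setW => x y; rewrite !inE => Ax Ay l l0 l1.
by rewrite inE; apply: cA => //; rewrite l0.
Qed.

End Convexity.

(** * The cone over a face of the state space *)

Section FaceCone.
Variables (R : realType) (E : peaType).
Implicit Types (F G : set (E -> R^o)) (m n k s : E -> R^o) (r : R).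

Lemma states_convex : convex_set (states R E).
Proof.
apply/convex_setE => x y l [mx x1] [my y1] /andP[l0 l1].
split; last by rewrite !fctE x1 y1 /GRing.scale /= !mulr1 addrC subrK.
by apply: measuresD; apply: measuresZ; rewrite ?subr_ge0 // ltW.
Qed.

Lemma face_cone_measure G m : G `<=` states R E -> face_cone G m ->
  measures R E m.
Proof.
move=> GS [->|[a [s [a0 /GS[ms _] ->]]]]; first exact: measures0.
exact: measuresZ.
Qed.

(** States take the value 1 at [pea1], so the coefficient of a cone member is its own value
    there. *)
Lemma face_cone_normalized G m : G `<=` states R E -> face_cone G m ->
  0 < m pea1 -> G ((m pea1)^-1 *: m).
Proof.
move=> GS [->|[a [s [a0 Gs ->]]]]; first by rewrite fctE ltxx.
have [_ s1] := GS _ Gs.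
have -> : (a *: s) pea1 = a by rewrite fctE s1 [LHS]mulr1.
by move=> a_gt0; rewrite scalerA mulVf ?gt_eqF // scale1r.
Qed.

Lemma face_cone_of_normalized G m : 0 < m pea1 -> G ((m pea1)^-1 *: m) ->
  face_cone G m.
Proof.
move=> m1 Gm; right; exists (m pea1), ((m pea1)^-1 *: m); split=> //.
  exact: ltW.
by rewrite scalerA mulfV ?gt_eqF // scale1r.
Qed.

Lemma face_coneZ G r m : 0 <= r -> face_cone G m -> face_cone G (r *: m).
Proof.
move=> r0 [->|[a [s [a0 Fs ->]]]]; first by left; rewrite scaler0.
by right; exists (r * a), s; rewrite mulr_ge0 // scalerA.
Qed.

(** For nonzero [m] and [n] the normalized sum is a convex combination of the normalized terms, with
    weight [m pea1 / (m + n) pea1] on the first. The face property gives one direction, convexity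
    the other. *)
Lemma face_coneD F m n : is_face (states R E) F ->
  measures R E m -> measures R E n ->
  face_cone F (m + n) <-> face_cone F m /\ face_cone F n.
Proof.
move=> [cF FS fF] mm mn.
have [m1|m1] := leP (m pea1) 0.
  by rewrite (measures_eq0 mm m1) add0r; split=> [|[]//]; split=> //; left.
have [n1|n1] := leP (n pea1) 0.
  by rewrite (measures_eq0 mn n1) addr0; split=> [|[]//]; split=> //; left.
have mn1 : 0 < (m + n) pea1 by rewrite fctE addr_gt0.
have mnE : (m + n) pea1 = m pea1 + n pea1 by [].
set l : R := m pea1 / (m + n) pea1.
have l01 : 0 < l < 1 by rewrite divr_gt0 // ltr_pdivrMr // mul1r mnE ltrDl.
have lm : l * (m pea1)^-1 = ((m + n) pea1)^-1.
  by rewrite /l mulrAC mulfV ?gt_eqF // mul1r.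
have ln : (1 - l) * (n pea1)^-1 = ((m + n) pea1)^-1.
  have -> : 1 - l = n pea1 / (m + n) pea1.
    by rewrite /l mnE; field; rewrite -mnE gt_eqF.
  by rewrite mulrAC mulfV ?gt_eqF // mul1r.
have eqmn : ((m + n) pea1)^-1 *: (m + n) =
    l *: ((m pea1)^-1 *: m) + (1 - l) *: ((n pea1)^-1 *: n).
  by rewrite scalerA lm scalerA ln -scalerDr.
split=> [Fmn|[Fm Fn]].
  have := face_cone_normalized FS Fmn mn1; rewrite eqmn => /fF.
  move=> /(_ (normalized_state mm m1) (normalized_state mn n1) l01) [Fm Fn].
  by split; exact: face_cone_of_normalized.
apply: face_cone_of_normalized => //; rewrite eqmn.
by apply: (convex_setE F).1 => //; exact: face_cone_normalized.
Qed.

Lemma face_cone_le F m n : is_face (states R E) F ->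
  measures R E m -> (m <= n)%O -> face_cone F n ->
  face_cone F m.
Proof.
move=> Fface mm mn Fn; have [_ FS _] := Fface.
have mnm := measuresB mm (face_cone_measure FS Fn) mn.
by have /(face_coneD Fface mm mnm)[] : face_cone F (m + (n - m))
  by rewrite addrC subrK.
Qed.

End FaceCone.

(** * Measures disjoint from the cone, and the complementary face *)

Section Disjoint.
Variables (R : realType) (E : peaType) (F : set (E -> R^o)).
Hypothesis (Fface : is_face (states R E) F).
Implicit Types (m n k s : E -> R^o) (r : R).

(** An order-theoretic form of membership in V(F'), easier to add and scale than a union of
    faces. *)
Definition disjoint_from_cone m :=
  measures R E m /\ forall k, face_cone F k -> (k <= m)%O -> k = 0.

Lemma disjoint_from_coneZ r m : 0 <= r -> disjoint_from_cone m ->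
  disjoint_from_cone (r *: m).
Proof.
move=> r0 [mm dm]; split=> [|k Fk /lefP km]; first exact: measuresZ.
have [_ FS _] := Fface; have mk := face_cone_measure FS Fk.
have [r_gt0|r_le0] := ltP 0 r; last first.
  apply: measures_eq0 => //; have := km pea1.
  by rewrite fctE (@le_anti _ _ r 0) ?r_le0 // scale0r.
have : r^-1 *: k = 0.
  apply: dm; first by apply: face_coneZ => //; rewrite invr_ge0.
  by apply/lefP => a; rewrite fctE /GRing.scale /= ler_pdivrMl //; exact: km.
by move/(congr1 ( *:%R r)); rewrite scalerA mulfV ?gt_eqF // scale1r scaler0.
Qed.

(** A cone member below [m + n] splits into parts below [m] and [n]; these lie in the cone again, so
    both vanish. *)
Lemma disjoint_from_coneD m n : RDP E ->
  disjoint_from_cone m -> disjoint_from_cone n -> disjoint_from_cone (m + n).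
Proof.
move=> rdp [mm dm] [mn dn]; split=> [|k Fk kmn]; first exact: measuresD.
have [_ FS _] := Fface; have mk := face_cone_measure FS Fk.
have [k1 [k2 [mk1 mk2 k1m k2n kE]]] := measures_riesz rdp mk mm mn kmn.
move: Fk; rewrite kE => /(face_coneD Fface mk1 mk2) [Fk1 Fk2].
by rewrite (dm _ Fk1) // (dn _ Fk2) // addr0.
Qed.

(** The face generated by [s], the candidate for a face through [s] that misses [F]. *)
Lemma generated_face s : states R E s ->
  is_face (states R E)
    [set t | states R E t /\ exists2 l : R, 0 < l & (l *: t <= s)%O].
Proof.
move=> Ss; split.
- apply/convex_setE => x y l [Sx [a a0 /lefP ax]] [Sy [b b0 /lefP yb]] l01.
  split; first by have /convex_setE cS := @states_convex R E; apply: cS.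
  (* The smaller constant serves both points, hence also their convex combination. *)
  exists (Num.min a b); first by rewrite lt_min a0.
  apply/lefP => e; have := ax e; have := yb e; have /andP[l0 l1] := l01.
  have := Sx.1.2 e; have := Sy.1.2 e; rewrite !fctE /GRing.scale /=.
  set c := Num.min a b; have ca : c <= a by rewrite ge_min lexx.
  have cb : c <= b by rewrite ge_min lexx orbT.
  move=> y0 x0 bys axs.
  have cx : c * x e <= s e by apply: le_trans axs; rewrite ler_wpM2r.
  have cy : c * y e <= s e by apply: le_trans bys; rewrite ler_wpM2r.
  by nra.
- by move=> t [].
- move=> x y l Sx Sy /andP[l0 l1] [Sxy [a a0 /lefP axy]].
  have l1' : 0 < 1 - l by rewrite subr_gt0.
  (* Each weighted term lies below the whole combination, so its weight is absorbed into the
     constant. *)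
  split; split=> //; [exists (a * l)|exists (a * (1 - l))]; rewrite ?mulr_gt0 //;
    apply/lefP => e; apply: le_trans (axy e); rewrite scalerDr !scalerA !fctE.
    by rewrite lerDl; apply: mulr_ge0 (Sy.1.2 e); apply: mulr_ge0; exact: ltW.
  by rewrite lerDr; apply: mulr_ge0 (Sx.1.2 e); apply: mulr_ge0; exact: ltW.
Qed.

(** If [s] is in a face [G] disjoint from [F], a nonzero cone member below [s] normalizes to a
    common point of [G] and [F]. Conversely, a point [t] of [F] in the face generated by [s] has a
    positive multiple in the cone below [s]; that multiple is 0, contradicting its value at
    [pea1]. *)
Lemma complementary_faceE s :
  complementary_face (states R E) F s <-> states R E s /\ disjoint_from_cone s.
Proof.
have [_ FS _] := Fface; split=> [[G /= [Gface GF] Gs]|[Ss [ms ds]]].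
  have [cG GS fG] := Gface; have Ss := GS _ Gs.
  split=> //; split=> [|k Fk ks]; first exact: Ss.1.
  have mk := face_cone_measure FS Fk.
  have [k1|k1] := leP (k pea1) 0; first exact: measures_eq0.
  have Gk : face_cone G k.
    by apply: face_cone_le ks _ => //; right; exists 1, s; rewrite scale1r.
  suff : (G `&` F) ((k pea1)^-1 *: k) by rewrite GF.
  by split; exact: face_cone_normalized.
exists [set t | states R E t /\ exists2 l : R, 0 < l & (l *: t <= s)%O] => /=.
  split; first exact: generated_face.
  apply/seteqP; split=> // t [[[_ t1] [l l0 lt]] Ft].
  have : l *: t = 0 by apply: ds => //; right; exists l, t; rewrite ltW.
  move/(congr1 (@^~ pea1)); rewrite fctE t1 [LHS]mulr1 => l_eq0.
  by move: l0; rewrite l_eq0 ltxx.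
by split=> //; exists 1 => //; rewrite scale1r.
Qed.

(** Normalization carries the description of F' over to its cone; the zero measure is treated
    apart. *)
Lemma cone_complementary_faceE m :
  face_cone (complementary_face (states R E) F) m <-> disjoint_from_cone m.
Proof.
split=> [[->|[a [s [a0 /complementary_faceE[_ ds] ->]]]]|dm].
- rewrite -(scale0r (0 : E -> R^o)); apply: disjoint_from_coneZ => //.
  split=> [|k Fk k0]; first exact: measures0.
  apply: measures_eq0; first by have [_ FS _] := Fface;
    exact: face_cone_measure Fk.
  exact: (lefP _ _ k0 pea1).
- exact: disjoint_from_coneZ.
have [m1|m1] := leP (m pea1) 0; first by left; exact: measures_eq0 dm.1 _.
apply: face_cone_of_normalized => //; apply/complementary_faceE; split.
  exact: normalized_state dm.1 _.
by apply: disjoint_from_coneZ => //; rewrite invr_ge0 ltW.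
Qed.

Lemma complementary_face_convex : RDP E ->
  convex_set (complementary_face (states R E) F).
Proof.
move=> rdp; apply/convex_setE => x y l /complementary_faceE[Sx dx].
move=> /complementary_faceE[Sy dy] l01; apply/complementary_faceE; split.
  by have /convex_setE cS := @states_convex R E; apply: cS.
by have /andP[l0 l1] := l01; apply: disjoint_from_coneD => //;
  apply: disjoint_from_coneZ; rewrite ?subr_ge0 // ltW.
Qed.

(** By symmetry one inequality between the cone parts suffices: Riesz decomposition splits [p1]
    along [q1 + q2], and the part below [q2] is in the cone, so it vanishes. *)
Lemma disjoint_decomposition_unique m1 m2 n1 n2 : RDP E ->
  face_cone F m1 -> disjoint_from_cone m2 ->
  face_cone F n1 -> disjoint_from_cone n2 ->
  m1 + m2 = n1 + n2 -> m1 = n1 /\ m2 = n2.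
Proof.
have [_ FS _] := Fface.
have le p1 p2 q1 q2 : RDP E -> face_cone F p1 -> disjoint_from_cone p2 ->
    face_cone F q1 -> disjoint_from_cone q2 -> p1 + p2 = q1 + q2 ->
    (p1 <= q1)%O.
  move=> rdp Fp dp Fq dq pq; have mp := face_cone_measure FS Fp.
  have /measures_riesz[] // : (p1 <= q1 + q2)%O.
  - by rewrite -pq; apply: measures_le_addr; exact: dp.1.
  - exact: face_cone_measure Fq.
  - exact: dq.1.
  move=> k1 [k2 [mk1 mk2 k1q k2q pE]].
  move: Fp; rewrite pE => /(face_coneD Fface mk1 mk2)[_ Fk2].
  by rewrite (dq.2 _ Fk2 k2q) addr0.
move=> rdp Fm dm Fn dn mn.
have mn1 : m1 = n1.
  apply/le_anti/andP; split; [exact: (le _ m2 _ n2)|exact: (le _ n2 _ m2)].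
by split=> //; move: mn; rewrite mn1 => /addrI.
Qed.

Lemma exists_disjoint_decomposition m : vee_closed (face_cone F) ->
  measures R E m -> exists n, [/\ face_cone F n, (n <= m)%O &
     disjoint_from_cone (m - n)].
Proof.
move=> vF mm; have [_ FS _] := Fface.
pose T := {n : E -> R^o | face_cone F n /\ (n <= m)%O}.
pose mkT n (Fn : face_cone F n) (nm : (n <= m)%O) : T := exist _ n (conj Fn nm).
have F0 : face_cone F 0 by left.
have m0 : ((0%R : E -> R^o) <= m)%O by apply/lefP => a; exact: mm.2.
have [] := @Zorn T (fun x y => sval x <= sval y)%O.
- by [].
- by move=> x y z; exact: le_trans.
- move=> [x px] [y py] /= xy yx; apply: eq_exist.
  by apply/le_anti/andP.
(* The empty chain is bounded by 0; [vee_closed] speaks only of nonempty chains. *)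
- move=> A Atot; have [A0|/set0P A0] := eqVneq A set0.
    by exists (mkT 0 F0 m0) => x; rewrite A0.
  pose C := [set sval x | x in A].
  have C0 : C !=set0 by have [x Ax] := A0; exists (sval x), x.
  have CF : C `<=` face_cone F by move=> _ [[x [Fx xm]] _ <-].
  have Cm : C `<=` measures R E by move=> x /CF; exact: face_cone_measure.
  have Cu : ubound C m by move=> _ [[x [Fx xm]] _ <-].
  have Ctot : total_on C <=%O by move=> _ _ [x Ax <-] [y Ay <-]; exact: Atot.
  have supF : face_cone F (pointwise_sup C).
    apply: vF C0 CF Ctot _ _ (pointwise_sup_jordan C0 Cm Ctot Cu).
    by exists m.
  have supm : (pointwise_sup C <= m)%O.
    by apply/lefP => a; apply: pointwise_sup_le => // k Ck; exact/lefP/Cu.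
  exists (mkT _ supF supm) => x Ax /=; apply/lefP => a.
  by apply: (le_pointwise_sup Cu); exists x.
move=> [n [Fn nm]] nmax; exists n; split=> //.
have mn := face_cone_measure FS Fn.
split=> [|k Fk /lefP kmn]; first exact: measuresB.
have mk := face_cone_measure FS Fk.
(* Adding [k] stays in the cone and below [m], so maximality forces [n + k = n]. *)
have Fnk : face_cone F (n + k) by apply/(face_coneD Fface)=> //; split.
have nkm : (n + k <= m)%O.
  by apply/lefP => a; have := kmn a; rewrite !fctE lerBrDl.
have := nmax (mkT _ Fnk nkm) (measures_le_addr n mk).
move=> /(congr1 sval) /= /(congr1 (fun f => f - n)).
by rewrite addrAC subrr add0r.
Qed.

End Disjoint.

(** * The direct convex sum and the decomposition of measures *)

Theorem theorem3p4 (R : realType) (E : peaType) (F : set (E -> R^o)) :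
  RDP E ->
  is_face (states R E) F ->
  vee_closed (face_cone F) ->
  let F' := complementary_face (states R E) F in
  direct_convex_sum (states R E) F F' /\
  (forall m : E -> R^o, measures R E m ->
     exists! m12 : (E -> R^o) * (E -> R^o),
       [/\ measures R E m12.1, measures R E m12.2,
           face_cone F m12.1, face_cone F' m12.2 & m = m12.1 + m12.2]).
Proof.
move=> rdp Fface vF F'; have [cF FS _] := Fface.
have F'S : F' `<=` states R E by move=> s /(complementary_faceE Fface)[].
have cF' : convex_set F' by exact: complementary_face_convex.
have coneF' m : face_cone F' m <-> disjoint_from_cone F m.
  exact: cone_complementary_faceE.
have decomp s : states R E s -> exists a1 x1 a2 x2,
    convex_comb2 F F' a1 x1 a2 x2 /\ s = a1 *: x1 + a2 *: x2.
  move=> [ms s1].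
  have [n [Fn ns dn]] := exists_disjoint_decomposition Fface vF ms.
  have F'n : face_cone F' (s - n) by apply/coneF'.
  have mn := face_cone_measure FS Fn.
  (* The coefficients are the values at [pea1], with sum [s pea1 = 1]. If one is 0, its vector is 0
     and is left unconstrained by [convex_comb2]. *)
  exists (n pea1), ((n pea1)^-1 *: n), ((s - n) pea1),
    (((s - n) pea1)^-1 *: (s - n)); split.
    split; [exact: mn.2|exact: dn.1.2| | |]; try exact: face_cone_normalized.
    by rewrite !fctE s1 addrCA subrr addr0.
  have scaleK k : measures R E k -> k pea1 *: ((k pea1)^-1 *: k) = k.
    move=> mk; have [k1|k1] := leP (k pea1) 0.
      by rewrite (measures_eq0 mk k1) !scaler0.
    by rewrite scalerA mulfV ?gt_eqF // scale1r.
  by rewrite (scaleK _ mn) (scaleK _ dn.1) addrC subrK.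
have coneZ G (a : R) (x : E -> R^o) : 0 <= a -> (0 < a -> G x) ->
    face_cone G (a *: x).
  move=> a0 Gx; have [a_gt0|a_le0] := ltP 0 a.
    by right; exists a, x; split=> //; exact: Gx.
  by left; rewrite (@le_anti _ _ a 0) ?a_le0 // scale0r.
split; first split=> //.
- apply/seteqP; split=> [s /decomp|].
    move=> [a [x [b [y [[a0 b0 ab Fx Fy] ->]]]]] G /= [cG FG].
    (* A term with coefficient 0 carries an arbitrary vector, so it is dropped before convexity of
       [G] is applied. *)
    have [a_gt0|a_le0] := ltP 0 a; last first.
      have aE : a = 0 by apply/le_anti; rewrite a_le0.
      have bE : b = 1 by rewrite -ab aE add0r.
      rewrite aE bE scale0r scale1r add0r; apply: FG; right; apply: Fy.
      by rewrite bE.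
    have [b_gt0|b_le0] := ltP 0 b; last first.
      have bE : b = 0 by apply/le_anti; rewrite b_le0.
      have aE : a = 1 by rewrite -ab bE addr0.
      by rewrite aE bE scale0r scale1r addr0; apply: FG; left; exact: Fx.
    have -> : b = 1 - a by rewrite -ab addrC addKr.
    apply: ((convex_setE _).1 cG).
    + by apply: FG; left; exact: Fx.
    + by apply: FG; right; exact: Fy.
    + by rewrite a_gt0 /= -ab ltrDl.
  by apply: smallest_sub; [exact: states_convex|rewrite subUset].
- move=> a1 x1 a2 x2 b1 y1 b2 y2 [a10 a20 _ Fx1 Fx2] [b10 b20 _ Fy1 Fy2] xy.
  (* Both sides split the same measure along V(F) and V(F'), so the scaled terms agree. *)
  have [e1 e2] : a1 *: x1 = b1 *: y1 /\ a2 *: x2 = b2 *: y2.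
    by apply: (disjoint_decomposition_unique Fface rdp) xy;
      try apply/coneF'; exact: coneZ.
  (* Evaluation at [pea1] recovers the coefficient, and then the state itself when the coefficient
     is positive. *)
  have eqS (a b : R) (x y : E -> R^o) : 0 <= a -> 0 <= b ->
      (0 < a -> states R E x) -> (0 < b -> states R E y) ->
      a *: x = b *: y -> a = b /\ (0 < a -> x = y).
    move=> a0 b0 Sx Sy axby.
    have val (c : R) z : 0 <= c -> (0 < c -> states R E z) -> (c *: z) pea1 = c.
      move=> c0 Sz; have [c_gt0|c_le0] := ltP 0 c.
        by rewrite fctE (Sz c_gt0).2 [LHS]mulr1.
      by rewrite (@le_anti _ _ c 0) ?c_le0 // scale0r.
    have ab : a = b by rewrite -(val a x) // axby val.
    split=> // a_gt0; move: axby; rewrite -ab => /scalerI; apply.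
    by rewrite gt_eqF.
  have [-> x1y1] := eqS _ _ _ _ a10 b10 (fun h => FS _ (Fx1 h))
    (fun h => FS _ (Fy1 h)) e1.
  have [-> x2y2] := eqS _ _ _ _ a20 b20 (fun h => F'S _ (Fx2 h))
    (fun h => F'S _ (Fy2 h)) e2.
  by split.
move=> m mm; have [n [Fn nm dn]] := exists_disjoint_decomposition Fface vF mm.
exists (n, m - n); split=> /= [|[n1 n2] /= [mn1 mn2 Fn1 /coneF' F'n2 mE]].
  split=> //; [exact: face_cone_measure Fn|exact: dn.1|exact/coneF'|].
  by rewrite addrC subrK.
have [||||||-> ->] // :=
  @disjoint_decomposition_unique _ _ _ Fface n (m - n) n1 n2.
by rewrite addrC subrK.
Qed.
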